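(* Let $A$ be a real symmetric matrix with HSS tree $\mathcal{T}$ whose root is at level $0$ and whose leaves are all at level $l_{\max}$, and let the matrices $\hat D_p$, $\Lambda_p$, $P_p$, $\hat Q_p$, $Q_p$ ($p\in\mathcal{T}$) be those produced by the (exact) dividing and conquering process described in the context. Assemble all the intermediate eigenmatrices and permutation matrices corresponding to the nodes at level $l$ of $\mathcal{T}$ as $$Q^{(l)}=\operatorname{diag}(\hat Q_i:\ i\text{ at level }l\text{ of }\mathcal{T}),\qquad P^{(l)}=\operatorname{diag}(P_i:\ i\text{ at level }l\text{ of }\mathcal{T}),$$ with diagonal blocks ordered from left to right in the tree. Then the final eigenmatrix $Q$ of $A$ has the form $$Q=Q^{(l_{\max})}\prod_{l=l_{\max}-1}^{0}\bigl((P^{(l)})^TQ^{(l)}\bigr),$$ where the factors are multiplied from left to right in order of decreasing $l=l_{\max}-1,\ldots,1,0$. In addition, $Q=Q_{p}$ with $p=\operatorname{root}(\mathcal{T})$, i.e. $Q$ is the matrix in the eigendecomposition $\hat D_p=Q_p\Lambda_pQ_p^T$, $Q_p=\operatorname{diag}(Q_i,Q_j)P_p^T\hat Q_p$, for $p=\operatorname{root}(\mathcal{T})$ with children $i,j$.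
   Context: $\mathcal{T}$ is a full binary tree; children of a node at level $l$ are at level $l+1$. The dividing stage yields symmetric matrices $\hat D_p$ for all nodes $p$ of $\mathcal{T}$, with $\hat D_{\operatorname{root}(\mathcal{T})}=A$, and for each nonleaf node $p$ with left child $i$ and right child $j$ a matrix $Z_p$ such that $$\hat D_p=\operatorname{diag}(\hat D_i,\hat D_j)+Z_pZ_p^T.$$ The conquering stage visits the nodes in postorder (children before parents). - For a leaf $i$: compute an eigendecomposition $\hat D_i=Q_i\Lambda_iQ_i^T$ with $Q_i$ orthogonal and $\Lambda_i$ diagonal, and set $\hat Q_i=Q_i$. - For a nonleaf node $p$ with children $i,j$: let $\hat Z_p=\operatorname{diag}(Q_i^T,Q_j^T)Z_p$, let $P_p$ be a permutation matrix (used for deflation and for ordering the diagonal entries of $\operatorname{diag}(\Lambda_i,\Lambda_j)$ from smallest to largest), and compute an eigendecomposition $$P_p\bigl[\operatorname{diag}(\Lambda_i,\Lambda_j)+\hat Z_p\hat Z_p^T\bigr]P_p^T=\hat Q_p\Lambda_p\hat Q_p^T$$ with $\hat Q_p$ orthogonal and $\Lambda_p$ diagonal. Set $Q_p=\operatorname{diag}(Q_i,Q_j)P_p^T\hat Q_p$, so that $\hat D_p=Q_p\Lambda_pQ_p^T$. $\hat Q_p$ is called an intermediate eigenmatrix and $Q_p$ a local eigenmatrix. The final eigenmatrix $Q$ is the orthogonal matrix in the decomposition $A=Q\Lambda Q^T$ delivered by this process at the root. *)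

(* Defs.v *)
From HB Require Import structures.
From mathcomp Require Import all_boot all_order all_algebra.
From mathcomp Require Import reals.
Set Implicit Arguments.
Unset Strict Implicit.
Unset Printing Implicit Defensive.
Import GRing.Theory.
Local Open Scope ring_scope.

(* A full binary tree; each leaf carries the order of its diagonal block. *)
Inductive hss_tree : Type :=
| HssLeaf of nat
| HssNode of hss_tree & hss_tree.

(* [hss_order (HssNode ti tj)] is convertible to
   [hss_order ti + hss_order tj], so that [block_mx] needs no cast. *)
Fixpoint hss_order (t : hss_tree) : nat :=
  match t with
  | HssLeaf n => n
  | HssNode ti tj => (hss_order ti + hss_order tj)%N
  end.

(* Levels of the leaves of [t], left to right, when the root of [t] is at
   level [l]. *)
Fixpoint leaf_levels (l : nat) (t : hss_tree) : seq nat :=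
  match t with
  | HssLeaf _ => [:: l]
  | HssNode ti tj => leaf_levels l.+1 ti ++ leaf_levels l.+1 tj
  end.

Definition orthogonal_mx (R : realType) (n : nat) (Q : 'M[R]_n) : Prop :=
  Q^T *m Q = 1%:M.

Definition diag2 (R : realType) (m n : nat) (B : 'M[R]_m) (C : 'M[R]_n) :
  'M[R]_(m + n) := block_mx B 0 0 C.

(* The matrices attached to the nodes of a tree; no equation between them is
   imposed here.  The arguments are
     leaf:    hat D, hat Q (= Q), Lambda;
     nonleaf: (the data of both subtrees) hat D, Z, P, hat Q, Lambda. *)
Inductive dc_data (R : realType) : hss_tree -> Type :=
| LeafData (n : nat) (D Qhat Lambda : 'M[R]_n) : dc_data R (HssLeaf n)
| NodeData (ti tj : hss_tree) (di : dc_data R ti) (dj : dc_data R tj) (r : nat)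
    (D : 'M[R]_(hss_order ti + hss_order tj)) (Z : 'M[R]_(hss_order ti + hss_order tj, r))
    (P Qhat Lambda : 'M[R]_(hss_order ti + hss_order tj)) : dc_data R (HssNode ti tj).

Definition hatD (R : realType) (t : hss_tree) (d : dc_data R t) :
    'M[R]_(hss_order t) :=
  match d in dc_data _ t return 'M[R]_(hss_order t) with
  | LeafData _ D _ _ => D
  | NodeData _ _ _ _ _ D _ _ _ _ => D
  end.

Definition hatQ (R : realType) (t : hss_tree) (d : dc_data R t) :
    'M[R]_(hss_order t) :=
  match d in dc_data _ t return 'M[R]_(hss_order t) with
  | LeafData _ _ Qhat _ => Qhat
  | NodeData _ _ _ _ _ _ _ _ Qhat _ => Qhat
  end.

Definition Lam (R : realType) (t : hss_tree) (d : dc_data R t) :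
    'M[R]_(hss_order t) :=
  match d in dc_data _ t return 'M[R]_(hss_order t) with
  | LeafData _ _ _ Lambda => Lambda
  | NodeData _ _ _ _ _ _ _ _ _ Lambda => Lambda
  end.

(* A leaf has no permutation matrix; the identity is a dummy value. *)
Definition Perm (R : realType) (t : hss_tree) (d : dc_data R t) :
    'M[R]_(hss_order t) :=
  match d in dc_data _ t return 'M[R]_(hss_order t) with
  | LeafData _ _ _ _ => 1%:M
  | NodeData _ _ _ _ _ _ _ P _ _ => P
  end.

Fixpoint local_eigenmx (R : realType) (t : hss_tree) (d : dc_data R t) :
    'M[R]_(hss_order t) :=
  match d in dc_data _ t return 'M[R]_(hss_order t) with
  | LeafData _ _ Qhat _ => Qhat
  | NodeData _ _ di dj _ _ _ P Qhat _ =>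
      diag2 (local_eigenmx di) (local_eigenmx dj) *m P^T *m Qhat
  end.

Fixpoint dividing (R : realType) (t : hss_tree) (d : dc_data R t) : Prop :=
  match d with
  | LeafData _ D _ _ => D^T = D
  | NodeData _ _ di dj _ D Z _ _ _ =>
      [/\ dividing di, dividing dj, D^T = D &
          D = diag2 (hatD di) (hatD dj) + Z *m Z^T]
  end.

Fixpoint conquering (R : realType) (t : hss_tree) (d : dc_data R t) : Prop :=
  match d with
  | LeafData _ D Qhat Lambda =>
      [/\ orthogonal_mx Qhat, is_diag_mx Lambda &
          D = Qhat *m Lambda *m Qhat^T]
  | NodeData _ _ di dj _ _ Z P Qhat Lambda =>
      let Zhat := diag2 (local_eigenmx di)^T (local_eigenmx dj)^T *m Z in
      [/\ conquering di /\ conquering dj,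
          is_perm_mx P, orthogonal_mx Qhat, is_diag_mx Lambda &
          P *m (diag2 (Lam di) (Lam dj) + Zhat *m Zhat^T) *m P^T
            = Qhat *m Lambda *m Qhat^T]
  end.

(* [Q] is obtained from the local eigenmatrices of the two children of the
   root of [t]; a leaf has no children and [Q] is its own eigenmatrix. *)
Definition merges_children (R : realType) (t : hss_tree) (d : dc_data R t) :
    'M[R]_(hss_order t) -> Prop :=
  match d in dc_data _ t return 'M[R]_(hss_order t) -> Prop with
  | LeafData _ _ Qhat _ => fun Q => Q = Qhat
  | NodeData _ _ di dj _ _ _ P Qhat _ => fun Q =>
      Q = diag2 (local_eigenmx di) (local_eigenmx dj) *m P^T *m Qhat
  end.

(* The nodes at level [l], left to right, each with the data of its subtree. *)
Fixpoint level_nodes (R : realType) (l : nat) (t : hss_tree)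
    (d : dc_data R t) : seq {u : hss_tree & dc_data R u} :=
  match l, d with
  | 0%N, d => [:: existT (dc_data R) _ d]
  | _.+1, LeafData _ _ _ _ => [::]
  | l'.+1, NodeData _ _ di dj _ _ _ _ _ _ =>
      level_nodes l' di ++ level_nodes l' dj
  end.

(* diag (F p : p at level l).  The order of this matrix is the sum of the
   orders of the nodes at level [l]; this is [hss_order t] only propositionally (see
   [level_dim]), and [conform_mx] casts it to that order.  The default value 0
   would only be returned if the two orders differed. *)
Definition level_diag (R : realType)
    (F : forall u : hss_tree, dc_data R u -> 'M[R]_(hss_order u))
    (l : nat) (t : hss_tree) (d : dc_data R t) : 'M[R]_(hss_order t) :=
  let s := level_nodes l d in
  conform_mx 0
    (\mxdiag_(i < size s) F (tag (tnth (in_tuple s) i))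
                            (tagged (tnth (in_tuple s) i))).

Definition level_Q (R : realType) (l : nat) (t : hss_tree)
  (d : dc_data R t) : 'M[R]_(hss_order t) := level_diag (@hatQ R) l d.

Definition level_P (R : realType) (l : nat) (t : hss_tree)
  (d : dc_data R t) : 'M[R]_(hss_order t) := level_diag (@Perm R) l d.

Lemma level_dim (R : realType) (lmax l : nat) (t : hss_tree)
    (d : dc_data R t) :
  all (pred1 lmax) (leaf_levels 0 t) -> (l <= lmax)%N ->
  (\sum_(i < size (level_nodes l d))
     hss_order (tag (tnth (in_tuple (level_nodes l d)) i)))%N = hss_order t.
Proof.
have leafS k u m : all (pred1 m.+1) (leaf_levels k.+1 u)
                   = all (pred1 m) (leaf_levels k u).
  elim: u k => [n|ui IHi uj IHj] k /=; first by rewrite eqSS.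
  by rewrite !all_cat IHi IHj.
rewrite -(big_tnth 0%N addn _ xpredT (fun x => hss_order (tag x))).
elim: d l lmax => [n D Q L|ti tj di IHi dj IHj r D Z P Q L] [|l] lmax /=;
  rewrite ?big_seq1 //.
  by case: lmax.
case: lmax => [|lmax]; first by [].
by rewrite all_cat !leafS big_cat /= => /andP[hi hj] ll; rewrite (IHi _ lmax) ?(IHj _ lmax).
Qed.

(* Main.v *)
(* At a nonleaf root, every level-(l+1) matrix is diag of the level-l matrices
   of the two subtrees, so the product over the levels l >= 1 is
   diag (Q_i, Q_j) by induction, and the level-0 factor is P_p^T hat Q_p. The
   eigendecomposition holds by induction: conjugating by diag (Q_i, Q_j) turns
   the update hat Z_p hat Z_p^T back into Z_p Z_p^T. *)
From HB Require Import structures.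
Require Import Defs.
From mathcomp Require Import all_boot all_order all_algebra.
From mathcomp Require Import fingroup perm reals.
Local Open Scope ring_scope.
Set Implicit Arguments.
Unset Strict Implicit.
Import GRing.Theory.

(* Square matrices of unspecified order: in this type equality absorbs the
   casts between propositionally equal orders, and the block-diagonal sum is
   strictly associative and unital. *)
Definition mxS (R : realType) (n : nat) (B : 'M[R]_n) :
  {n : nat & 'M[R]_n} := Tagged (fun n => 'M[R]_n) B.

Definition dsum (R : realType) (u v : {n : nat & 'M[R]_n}) :=
  mxS (diag2 (tagged u) (tagged v)).

(** Equality on [nat] is decidable, so an identity of packed matrices of one order descends to
    ['M[R]_n]; this is the way back from [mxS]. *)
Lemma mxS_inj (R : realType) (n : nat) : injective (@mxS R n).
Proof. by move=> B C /eqP; rewrite eq_Tagged => /eqP. Qed.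

Lemma mxS_cast (R : realType) (m n : nat) (e e' : m = n) (B : 'M[R]_m) :
  mxS (castmx (e, e') B) = mxS B.
Proof. by case: n / e e' => e'; rewrite castmx_id. Qed.

Lemma mxS_conform (R : realType) (m n : nat) (C : 'M[R]_n) (B : 'M[R]_m) :
  m = n -> mxS (conform_mx C B) = mxS B.
Proof. by move=> e; case: n / e C => C; rewrite conform_mx_id. Qed.

Lemma dsumA (R : realType) : associative (@dsum R).
Proof.
move=> [m B] [n C] [p D]; rewrite /dsum /= /diag2.
rewrite -(mxS_cast (esym (addnA _ _ _)) (esym (addnA _ _ _))
  (block_mx (block_mx B 0 0 C) 0 0 D)).
(* [block_mxA] expects the outer zero blocks in split form. *)
rewrite -[0 in LHS](@row_mx0 R m n p) -[X in block_mx _ _ X _](@col_mx0 R n p m).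
by rewrite block_mxA /= -!(row_mx0, col_mx0).
Qed.

Lemma dsum0l (R : realType) : left_id (mxS (0 : 'M[R]_0)) (@dsum R).
Proof.
move=> [m B]; rewrite /dsum /diag2 /=.
by rewrite /block_mx row_thin_mx col_flat_mx row_thin_mx.
Qed.

Lemma dsum0r (R : realType) : right_id (mxS (0 : 'M[R]_0)) (@dsum R).
Proof.
(* [m + 0] does not reduce to [m], unlike [0 + m], hence the explicit cast. *)
move=> [m B]; rewrite /dsum /diag2 /= -(mxS_cast (addn0 m) (addn0 m)).
congr mxS; apply/matrixP=> i j; rewrite castmxE.
have shiftE k : cast_ord (esym (addn0 m)) k = lshift 0 k by exact: val_inj.
by rewrite !shiftE block_mxEul.
Qed.

(** The two monoid laws allow ordered iterations of [dsum] and [mulmx] to be split by [big_cat] and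
    [big_rcons]. *)
HB.instance Definition _ (R : realType) :=
  Monoid.isLaw.Build {n : nat & 'M[R]_n} (mxS (0 : 'M[R]_0)) (@dsum R)
    (@dsumA R) (@dsum0l R) (@dsum0r R).

HB.instance Definition _ (R : realType) (n : nat) :=
  Monoid.isLaw.Build 'M[R]_n 1%:M (@mulmx R n n n)
    (@mulmxA R n n n n) (@mul1mx R n n) (@mulmx1 R n n).

Lemma mxS_mxdiag (R : realType) (n : nat) (p : 'I_n -> nat)
    (B : forall i, 'M[R]_(p i)) :
  mxS (\mxdiag_i B i) = \big[@dsum R/mxS (0 : 'M[R]_0)]_(i < n) mxS (B i).
Proof.
elim: n p B => [|n IHn] p B.
  rewrite big_ord0.
  have e : (\sum_(i < 0) p i)%N = 0%N by rewrite big_ord0.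
  by rewrite -(mxS_cast e e); congr mxS; exact: flatmx0.
by rewrite mxdiag_recl mxS_cast big_ord_recl -IHn.
Qed.

(** With all leaves at level [lmax], [level_dim] makes the orders agree, so [conform_mx] is a mere
    cast and its default 0 never appears. *)
Lemma mxS_level_diag (R : realType)
    (F : forall u : hss_tree, dc_data R u -> 'M[R]_(hss_order u))
    (lmax l : nat) (t : hss_tree) (d : dc_data R t) :
  all (pred1 lmax) (leaf_levels 0 t) -> (l <= lmax)%N ->
  mxS (level_diag F l d) =
    \big[@dsum R/mxS (0 : 'M[R]_0)]_(x <- level_nodes l d)
       mxS (F (tag x) (tagged x)).
Proof.
move=> ht ll; rewrite mxS_conform; last exact: level_dim ht ll.
by rewrite mxS_mxdiag big_tnth.
Qed.

Lemma leaf_levelsS (l : nat) (t : hss_tree) :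
  leaf_levels l.+1 t = map S (leaf_levels l t).
Proof. by elim: t l => //= ti IHi tj IHj l; rewrite map_cat IHi IHj. Qed.

Lemma leaf_levels_node (lmax : nat) (ti tj : hss_tree) :
  all (pred1 lmax) (leaf_levels 0 (HssNode ti tj)) ->
  exists l, [/\ lmax = l.+1, all (pred1 l) (leaf_levels 0 ti)
              & all (pred1 l) (leaf_levels 0 tj)].
Proof.
rewrite /= !leaf_levelsS all_cat !all_map.
case: lmax => [|l]; last by move=> /andP[hi hj]; exists l.
(* Leaves below an inner root have positive level, so [lmax = 0] could hold only if [ti] had no
   leaves. *)
suff: (0 < size (leaf_levels 0 ti))%N by case: (leaf_levels 0 ti).
elim: {tj} ti => //= ui IHi uj _.
by rewrite !leaf_levelsS size_cat !size_map ltn_addr.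
Qed.

Lemma level_diag0 (R : realType)
    (F : forall u : hss_tree, dc_data R u -> 'M[R]_(hss_order u))
    (t : hss_tree) (d : dc_data R t) :
  level_diag F 0 d = F t d.
Proof.
apply: mxS_inj; rewrite mxS_conform ?mxS_mxdiag ?big_ord_recl ?big_ord0 ?addn0 //.
by rewrite Monoid.mulm1.
Qed.

(** The node list at level [l.+1] is the concatenation of the two subtree lists at level [l];
    cutting the iterated [dsum] there yields the two blocks. *)
Lemma level_diagS (R : realType)
    (F : forall u : hss_tree, dc_data R u -> 'M[R]_(hss_order u))
    (lmax l : nat) (ti tj : hss_tree) (di : dc_data R ti) (dj : dc_data R tj)
    (r : nat) D (Z : 'M_(_, r)) P Qhat Lambda :
  all (pred1 lmax) (leaf_levels 0 ti) -> all (pred1 lmax) (leaf_levels 0 tj) ->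
  (l <= lmax)%N ->
  level_diag F l.+1 (NodeData di dj D Z P Qhat Lambda) =
    diag2 (level_diag F l di) (level_diag F l dj).
Proof.
move=> hi hj ll; apply: mxS_inj.
rewrite (@mxS_level_diag _ _ lmax.+1) //; last first.
  by rewrite /= !leaf_levelsS all_cat !all_map; apply/andP.
rewrite big_cat -!(@mxS_level_diag _ _ lmax) //.
Qed.

Lemma diag2_mul (R : realType) (m n : nat) (B B' : 'M[R]_m) (C C' : 'M[R]_n) :
  diag2 B C *m diag2 B' C' = diag2 (B *m B') (C *m C').
Proof. by rewrite mulmx_block !(mul0mx, mulmx0, addr0, add0r). Qed.

Lemma diag2_tr (R : realType) (m n : nat) (B : 'M[R]_m) (C : 'M[R]_n) :
  (diag2 B C)^T = diag2 B^T C^T.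
Proof. by rewrite tr_block_mx !trmx0. Qed.

Lemma diag2_1 (R : realType) (m n : nat) :
  diag2 1%:M 1%:M = 1%:M :> 'M[R]_(m + n).
Proof. by rewrite [RHS]scalar_mx_block. Qed.

Lemma local_eigenmx_levels (R : realType) (lmax : nat) (t : hss_tree)
    (d : dc_data R t) :
  all (pred1 lmax) (leaf_levels 0 t) ->
  local_eigenmx d = level_Q lmax d *m
    \big[mulmx/1%:M]_(l <- rev (iota 0 lmax))
       ((level_P l d)^T *m level_Q l d).
Proof.
elim: d lmax => [n D Qhat L|ti tj di IHi dj IHj r D Z P Qhat L] lmax.
  rewrite /= andbT => /eqP <-.
  by rewrite big_nil mulmx1 /level_Q level_diag0.
move=> /leaf_levels_node[l [-> hi hj]]; rewrite [LHS]/= (IHi l) // (IHj l) //.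
(* Level 0 comes last in the reversed list, so its factor splits off on the right; the remaining
   levels are reindexed as [1 + k] to suit [level_diagS]. *)
rewrite /= rev_cons big_rcons -(addn0 1%N) iotaDl -map_rev big_map /=.
rewrite /level_P /level_Q !level_diag0 /= (@level_diagS R _ l) //.
rewrite -diag2_mul !mulmxA; congr (_ *m _ *m _); congr (_ *m _).
(* The induction runs over an arbitrary list of levels, so the bound needed by [level_diagS] is
   carried along as a property of its elements. *)
have: all (fun k => k <= l)%N (rev (iota 0 l)).
  by rewrite all_rev; apply/allP=> k; rewrite mem_iota => /andP[_ /ltnW].
elim: (rev _) => [|k s IHs] /=; first by rewrite !big_nil diag2_1.
move=> /andP[kl /IHs eq_s]; rewrite !big_cons -!eq_s -diag2_mul eq_s.
by rewrite !(@level_diagS R _ l) // diag2_tr diag2_mul.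
Qed.

Lemma orthogonal_mxC (R : realType) (n : nat) (Q : 'M[R]_n) :
  orthogonal_mx Q -> Q *m Q^T = 1%:M.
Proof. exact: mulmx1C. Qed.

Lemma orthogonal_mxM (R : realType) (n : nat) (Q S : 'M[R]_n) :
  orthogonal_mx Q -> orthogonal_mx S -> orthogonal_mx (Q *m S).
Proof.
by move=> hQ hS; rewrite /orthogonal_mx trmx_mul mulmxA -(mulmxA S^T) hQ mulmx1.
Qed.

Lemma orthogonal_mx_tr (R : realType) (n : nat) (Q : 'M[R]_n) :
  orthogonal_mx Q -> orthogonal_mx Q^T.
Proof. by move=> /orthogonal_mxC; rewrite /orthogonal_mx trmxK. Qed.

Lemma orthogonal_mx_diag2 (R : realType) (m n : nat)
    (B : 'M[R]_m) (C : 'M[R]_n) :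
  orthogonal_mx B -> orthogonal_mx C -> orthogonal_mx (diag2 B C).
Proof.
by rewrite /orthogonal_mx diag2_tr diag2_mul => -> ->; rewrite diag2_1.
Qed.

Lemma orthogonal_perm_mx (R : realType) (n : nat) (P : 'M[R]_n) :
  is_perm_mx P -> orthogonal_mx P.
Proof.
case/is_perm_mxP=> s ->.
by rewrite /orthogonal_mx tr_perm_mx -perm_mxM mulVg perm_mx1.
Qed.

Lemma Lam_diag (R : realType) (t : hss_tree) (d : dc_data R t) :
  conquering d -> is_diag_mx (Lam d).
Proof. by case: d => [n D Q L|ti tj di dj r D Z P Q L] []. Qed.

Lemma local_eigenmx_orthogonal (R : realType) (t : hss_tree)
    (d : dc_data R t) :
  conquering d -> orthogonal_mx (local_eigenmx d).
Proof.
elim: d => [n D Q L|ti tj di IHi dj IHj r D Z P Q L] /=; first by case.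
case=> [[/IHi oi /IHj oj] /orthogonal_perm_mx oP oQ _ _].
apply: orthogonal_mxM oQ; apply: orthogonal_mxM; last exact: orthogonal_mx_tr.
exact: orthogonal_mx_diag2.
Qed.

Lemma local_eigendecomposition (R : realType) (t : hss_tree)
    (d : dc_data R t) :
  dividing d -> conquering d ->
  hatD d = local_eigenmx d *m Lam d *m (local_eigenmx d)^T.
Proof.
elim: d => [n D Q L|ti tj di IHi dj IHj r D Z P Q L] /=; first by move=> _ [].
move=> [vi vj _ ->] [[ci cj] pP oQ _ eqP].
rewrite (IHi vi ci) (IHj vj cj).
set W := diag2 (local_eigenmx di) (local_eigenmx dj).
have oW : W *m W^T = 1%:M.
  by apply/orthogonal_mxC/orthogonal_mx_diag2; exact: local_eigenmx_orthogonal.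
have oP := orthogonal_perm_mx pP.
set S := diag2 (Lam di) (Lam dj) + _ in eqP.
(* Orthogonality of [P] solves the intermediate eigendecomposition for [S], which absorbs [P], [Q]
   and [L]. *)
have -> : W *m P^T *m Q *m L *m (W *m P^T *m Q)^T = W *m S *m W^T.
  have -> : S = P^T *m (Q *m L *m Q^T) *m P.
    by rewrite -eqP !mulmxA oP mul1mx -mulmxA oP mulmx1.
  by rewrite !trmx_mul trmxK !mulmxA.
rewrite /S -diag2_tr -/W mulmxDr mulmxDl trmx_mul trmxK.
rewrite !mulmxA oW mul1mx -!mulmxA oW mulmx1; congr (_ + _).
by rewrite diag2_tr !diag2_mul !mulmxA.
Qed.

Theorem lemma4p2 (R : realType) (t : hss_tree) (lmax : nat)
    (A : 'M[R]_(hss_order t)) (d : dc_data R t) :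
  A^T = A ->
  (forall k : nat, k \in leaf_levels 0 t -> k = lmax) ->
  hatD d = A ->
  dividing d ->
  conquering d ->
  let Q := local_eigenmx d in
  [/\ Q = level_Q lmax d *m
          \big[mulmx/1%:M]_(l <- rev (iota 0 lmax))
             ((level_P l d)^T *m level_Q l d),
      orthogonal_mx Q,
      is_diag_mx (Lam d),
      A = Q *m Lam d *m Q^T
    & merges_children d Q].
Proof.
move=> _ ht <- hdiv hconq; split.
- by apply: local_eigenmx_levels; apply/allP=> k /ht /eqP.
- exact: local_eigenmx_orthogonal.
- exact: Lam_diag.
- exact: local_eigendecomposition.
(* Once the root constructor is exposed, [local_eigenmx] computes to the required merge. *)
- by case: {ht hdiv hconq} d.
Qed.
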